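(* In the trilevel setting, let $\Omega:=\{x\in\mathrm{Fix}(W):\langle (I-T)x,y-x\rangle\ge0\ \forall y\in\mathrm{Fix}(W)\}$ be nonempty. Assume $\lim_{k\to\infty}\beta_k/\alpha_k=+\infty$, $\beta_k\to0$, $\alpha_k\to0$, $\sum_k\alpha_k=\infty$, there is $K>0$ with $\limsup_{k}\frac1{\alpha_k}\left|\frac1{\beta_k}-\frac1{\beta_{k-1}}\right|\le K$, $\limsup_{k}\frac{|\beta_k-\beta_{k-1}|+|\alpha_k-\alpha_{k-1}|}{\alpha_k\beta_k}=0$, and that the trilevel iteration sequence $\{x^k\}$ is bounded. Suppose further $(A_1)''$ $\limsup_{k\to\infty}\frac{d(x^{k+1},\mathrm{Fix}(W))}{\alpha_k}<\infty$. Then $\{x^k\}$ converges to the unique $x^*\in\Omega$ satisfying $\langle x^*-S(x^* ),x-x^*\rangle\ge0$ for all $x\in\Omega$.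
   Context: Trilevel setting. Let $f_1,f_2:\mathbb R^n\to\mathbb R$ be convex and continuously differentiable with $L_{f_i}$-Lipschitz gradients, and $g_1,g_2:\mathbb R^n\to(-\infty,+\infty]$ proper, lower semicontinuous and convex; put $\phi_i=f_i+g_i$. Let $\omega:\mathbb R^n\to\mathbb R$ be $\mu$-strongly convex and continuously differentiable with $L_\omega$-Lipschitz gradient. Let $Y^*=\arg\min_{x\in\mathbb R^n}\phi_2(x)$ and $X^*=\arg\min_{x\in Y^*}\phi_1(x)$, both assumed nonempty. For a proper lsc convex $g$, $\mathrm{prox}_g(x)=\arg\min_{u}\{g(u)+\tfrac12\|u-x\|^2\}$. Fix $u\in(0,\tfrac{2}{L_\omega+\mu}]$, $t\in(0,1/L_{f_1}]$, $s\in(0,1/L_{f_2}]$ and define $S(x)=x-u\nabla\omega(x)$, $T(x)=\mathrm{prox}_{tg_1}(x-t\nabla f_1(x))$, $W(x)=\mathrm{prox}_{sg_2}(x-s\nabla f_2(x))$. Then $S$ is a contraction with constant $r=\sqrt{1-\tfrac{2u\mu L_\omega}{\mu+L_\omega}}\in[0,1)$, $T,W$ are nonexpansive, $\mathrm{Fix}(W)=Y^*$. Given $x^0\in\mathbb R^n$ and real sequences $\alpha_k,\beta_k\in(0,1)$, the trilevel iteration sequence is $x^{k+1}=\alpha_kS(x^k)+(1-\alpha_k)\beta_kT(x^k)+(1-\alpha_k)(1-\beta_k)W(x^k)$, $k\ge0$. $I$ is the identity, $d(x,A)=\inf_{a\in A}\|x-a\|$. *)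

(* Defs.v *)
From HB Require Import structures.
From mathcomp Require Import all_boot all_order all_algebra.
From mathcomp Require Import all_classical all_reals all_analysis.
Set Implicit Arguments. Unset Strict Implicit. Unset Printing Implicit Defensive.
Import Order.TTheory GRing.Theory Num.Theory.
Import numFieldNormedType.Exports.
Local Open Scope ring_scope.
Local Open Scope classical_set_scope.

Section Defs.
Context {R : realType} {n : nat}.
Notation vec := 'rV[R]_n.

Definition dotp (u v : vec) : R := \sum_(i < n) u ord0 i * v ord0 i.
Definition enorm (u : vec) : R := Num.sqrt (dotp u u).

Definition dist (x : vec) (A : set vec) : R := inf [set enorm (x - a) | a in A].

Definition has_gradient (f : vec -> R) (g : vec -> vec) : Prop :=
  forall x (eps : R), 0 < eps -> exists2 delta : R, 0 < delta &
    forall h : vec, enorm h < delta ->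
      `|f (x + h) - f x - dotp (g x) h| <= eps * enorm h.

Definition lipschitz_with (L : R) (F : vec -> vec) : Prop :=
  forall x y, enorm (F x - F y) <= L * enorm (x - y).

Definition convex_fun (f : vec -> R) : Prop :=
  forall x y (l : R), 0 <= l <= 1 ->
    f (l *: x + (1 - l) *: y) <= l * f x + (1 - l) * f y.

Definition strongly_convex_fun (mu : R) (f : vec -> R) : Prop :=
  forall x y (l : R), 0 <= l <= 1 ->
    f (l *: x + (1 - l) *: y) <=
      l * f x + (1 - l) * f y - mu / 2 * l * (1 - l) * enorm (x - y) ^+ 2.

Definition proper_efun (g : vec -> \bar R) : Prop :=
  (exists x, g x < +oo)%E /\ (forall x, -oo < g x)%E.

Definition lsc_efun (g : vec -> \bar R) : Prop :=
  forall x (t : R), (t%:E < g x)%E -> exists2 delta : R, 0 < delta &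
    forall y : vec, enorm (y - x) < delta -> (t%:E < g y)%E.

Definition convex_efun (g : vec -> \bar R) : Prop :=
  forall (x y : vec) (l : R), 0 < l < 1 ->
    let z : vec := l *: x + (1 - l) *: y in
    (g z <= l%:E * g x + (1 - l)%:E * g y)%E.

Definition is_prox (c : R) (g : vec -> \bar R) (x p : vec) : Prop :=
  forall u : vec, let a : R := enorm (p - x) ^+ 2 / 2 in
    let b : R := enorm (u - x) ^+ 2 / 2 in
    (c%:E * g p + a%:E <= c%:E * g u + b%:E)%E.

Definition is_argmin_on (A : set vec) (phi : vec -> \bar R) (z : vec) : Prop :=
  A z /\ forall y, A y -> (phi z <= phi y)%E.

Definition fixpoints (F : vec -> vec) : set vec := [set x | F x = x].

End Defs.

(* Main.v *)
Require Import Defs.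
From HB Require Import structures.
From mathcomp Require Import all_boot all_order all_algebra.
From mathcomp Require Import all_classical all_reals all_analysis.
From mathcomp Require Import ring lra.
Import Order.TTheory GRing.Theory Num.Theory.
Import numFieldNormedType.Exports.
Local Open Scope ring_scope.
Local Open Scope classical_set_scope.

(** The gradient step S is an r-contraction (co-coercivity of the gradient of
    omega - mu/2 |.|^2) and T, W are nonexpansive.  By Minty's lemma Omega is
    closed and convex, and since x - S x = u grad omega(x), the minimizer x* of
    omega on Omega solves the variational inequality; contractivity of S gives
    uniqueness.

    The increments satisfy a recursion with contraction factor 1 - (1-r) alpha_k
    and the variation of the parameters as error term; dividing it by beta_k
    shows |x^{k+1} - x^k| = o(beta_k).  Reading this off the scheme, x^k - W x^k
    tends to 0 and limsup <(I-T) y, x^k - y> <= 0 for y in Fix W, so cluster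
    points lie in Omega and limsup <S x* - x*, x^k - x*> <= 0.  Finally

      |x^{k+1} - x*|^2 <= (1 - (1-r) alpha_k) |x^k - x*|^2
        + 2 alpha_k <S x* - x*, x^{k+1} - x*>
        + 2 (1 - alpha_k) beta_k <T x* - x*, x^{k+1} - x*>.

    As <T x* - x*, q - x*> <= 0 for q in Fix W, (A1)'' bounds the last inner
    product by O(alpha_k), so the last term is alpha_k O(beta_k) = o(alpha_k). *)

(** * Euclidean geometry of row vectors *)

Section Euclidean.
Set Implicit Arguments.
Unset Strict Implicit.
Context {R : realType} {n : nat}.
Implicit Types (x y z v w : 'rV[R]_n) (a b e : R).

Lemma dotpC v w : dotp v w = dotp w v.
Proof. by apply: eq_bigr => i _; rewrite mulrC. Qed.

Lemma dotpDl x y z : dotp (x + y) z = dotp x z + dotp y z.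
Proof. by rewrite -big_split; apply: eq_bigr => i _; rewrite mxE mulrDl. Qed.

Lemma dotpZl a x z : dotp (a *: x) z = a * dotp x z.
Proof. by rewrite mulr_sumr; apply: eq_bigr => i _; rewrite mxE mulrA. Qed.

Lemma dotpNl x z : dotp (- x) z = - dotp x z.
Proof. by rewrite -scaleN1r dotpZl mulN1r. Qed.

Lemma dotpDr x y z : dotp z (x + y) = dotp z x + dotp z y.
Proof. by rewrite dotpC dotpDl !(dotpC z). Qed.

Lemma dotpZr a x z : dotp z (a *: x) = a * dotp z x.
Proof. by rewrite dotpC dotpZl (dotpC z). Qed.

Lemma dotpNr x z : dotp z (- x) = - dotp z x.
Proof. by rewrite dotpC dotpNl (dotpC z). Qed.

Definition dotpE := (dotpDl, dotpDr, dotpZl, dotpZr, dotpNl, dotpNr).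

Lemma dotp0l z : dotp 0 z = 0.
Proof. by rewrite -(scale0r z) dotpZl mul0r. Qed.

Lemma dotp0r z : dotp z 0 = 0.
Proof. by rewrite dotpC dotp0l. Qed.

Lemma dotp_ge0 v : 0 <= dotp v v.
Proof. by apply: sumr_ge0 => i _; rewrite -expr2 sqr_ge0. Qed.

Lemma sqr_enorm v : enorm v ^+ 2 = dotp v v.
Proof. by rewrite sqr_sqrtr// dotp_ge0. Qed.

Lemma enorm_ge0 v : 0 <= enorm v.
Proof. exact: sqrtr_ge0. Qed.

Lemma enormZ a v : enorm (a *: v) = `|a| * enorm v.
Proof. by rewrite /enorm !dotpE mulrA sqrtrM -?expr2 ?sqr_ge0// sqrtr_sqr. Qed.

Lemma enormN v : enorm (- v) = enorm v.
Proof. by rewrite -scaleN1r enormZ normrN1 mul1r. Qed.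

Lemma enormBC v w : enorm (v - w) = enorm (w - v).
Proof. by rewrite -enormN opprB. Qed.

Lemma enorm0 : enorm (0 : 'rV[R]_n) = 0.
Proof. by rewrite /enorm dotp0l sqrtr0. Qed.

Lemma enorm_eq0 v : enorm v = 0 -> v = 0.
Proof.
move=> v0; apply/rowP => i; rewrite mxE; apply/eqP; rewrite -sqrf_eq0 expr2.
have : dotp v v == 0 by rewrite -sqr_enorm v0 expr0n.
rewrite psumr_eq0; last by move=> j _; rewrite -expr2 sqr_ge0.
by move=> /allP/(_ i); rewrite mem_index_enum => /(_ isT).
Qed.

(** Cauchy-Schwarz: expand the squared length of [enorm w *: v - enorm v *: w] and cancel the
    positive factor [enorm v * enorm w]. *)
Lemma dotp_le v w : dotp v w <= enorm v * enorm w.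
Proof.
have [/enorm_eq0->|v0] := eqVneq (enorm v) 0.
  by rewrite dotp0l enorm0 mul0r.
have [/enorm_eq0->|w0] := eqVneq (enorm w) 0.
  by rewrite dotp0r enorm0 mulr0.
have vw : 0 < enorm v * enorm w by rewrite mulr_gt0// lt_def ?v0 ?w0 enorm_ge0.
have := dotp_ge0 (enorm w *: v - enorm v *: w).
rewrite !dotpE -!sqr_enorm (dotpC w v) => h.
rewrite -subr_ge0 -(pmulr_rge0 _ vw); lra.
Qed.

Lemma dotp_norm v w : `|dotp v w| <= enorm v * enorm w.
Proof.
by rewrite ler_norml dotp_le andbT lerNl -dotpNl (le_trans (dotp_le _ _))// enormN.
Qed.

Lemma enormD v w : enorm (v + w) <= enorm v + enorm w.
Proof.
rewrite -(@ler_pXn2r _ 2)// ?nnegrE ?addr_ge0 ?enorm_ge0//.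
rewrite sqr_enorm !dotpE (dotpC w v) sqrrD !sqr_enorm.
have := dotp_le v w; lra.
Qed.

Lemma enorm_triangle y x z : enorm (x - z) <= enorm (x - y) + enorm (y - z).
Proof. by rewrite (le_trans _ (enormD _ _))// subrKA. Qed.

Lemma sqr_enorm_convex a x y :
  enorm (a *: x + (1 - a) *: y) ^+ 2 =
    a * enorm x ^+ 2 + (1 - a) * enorm y ^+ 2 - a * (1 - a) * enorm (x - y) ^+ 2.
Proof. by rewrite !sqr_enorm !dotpE (dotpC y x); ring. Qed.

Lemma sqr_enormD_le x y : enorm (x + y) ^+ 2 <= enorm x ^+ 2 + 2 * dotp y (x + y).
Proof.
rewrite !sqr_enorm !dotpE (dotpC y x); have := dotp_ge0 y; lra.
Qed.

(** The topology on row vectors comes from the sup norm; this bound and the next one carry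
    convergence and compactness between it and [enorm]. *)
Lemma norm_le_enorm v : `|v| <= enorm v.
Proof.
rewrite [leLHS]/Num.Def.normr /= mx_normrE; apply: bigmax_le => [|[i j] _ /=].
  exact: enorm_ge0.
rewrite -sqrtr_sqr ler_wsqrtr// (ord1 i) /dotp (bigD1 j)//= expr2 lerDl.
by apply: sumr_ge0 => k _; rewrite -expr2 sqr_ge0.
Qed.

Lemma enorm_le_norm v : enorm v <= Num.sqrt n%:R * `|v|.
Proof.
rewrite -(ler_pXn2r (ltn0Sn 1)) ?nnegrE ?mulr_ge0 ?sqrtr_ge0 ?normr_ge0//.
rewrite exprMn sqr_enorm sqr_sqrtr ?ler0n// mulr_natl.
rewrite -[X in _ *+ X](card_ord n) -sumr_const; apply: ler_sum => i _.
rewrite -expr2 -real_normK ?num_real// ler_pXn2r ?nnegrE//.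
by rewrite [leRHS]/Num.Def.normr /= mx_normrE (le_bigmax _ _ (ord0, i)).
Qed.

(** The predicate [Q] stands for a subsequence: a cluster point is taken along the indices
    satisfying [Q], so none has to be extracted. *)
Lemma bolzano_weierstrass_along (x : nat -> 'rV[R]_n) (M : R) (Q : nat -> Prop) :
  (forall k, enorm (x k) <= M) ->
  (forall N, exists2 k, (N <= k)%N & Q k) ->
  exists p, forall e, 0 < e -> forall N,
    exists k, [/\ (N <= k)%N, Q k & enorm (x k - p) < e].
Proof.
move=> xM Qx.
pose F : set_system 'rV[R]_n := x @ within Q \oo.
have FF : ProperFilter F.
  apply: fmap_proper_filter; apply: Build_ProperFilter_ex => A [N _ NA].
  by have [k Nk Qk] := Qx N; exists k; apply: NA.
pose A : set 'rV[R]_n := [set v | `|v| <= M].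
have cA : compact A.
  apply: bounded_closed_compact.
    exists M; split; first exact: num_real.
    by move=> m Mm v vM; rewrite /= (le_trans vM)// ltW.
  apply: (@closed_comp _ _ (fun v : 'rV[R]_n => `|v|) [set r | r <= M]).
    by move=> v _; exact: norm_continuous.
  exact: closed_le.
have FA : F A by exists 0%N => // k _ _; exact: le_trans (norm_le_enorm _) (xM k).
have [p [_ Fp]] := cA F FF FA.
exists p => e e0 N.
(* The [+ 1] keeps the denominator positive when [n] is 0. *)
pose d := e / (Num.sqrt n%:R + 1).
have s0 : 0 < Num.sqrt n%:R + 1 :> R by rewrite ltr_wpDl// sqrtr_ge0.
have d0 : 0 < d by rewrite divr_gt0.
have [|_ [[k [Nk Qk] <-] pk]] :=
  Fp (x @` [set k | (N <= k)%N /\ Q k]) _ _ (nbhsx_ballx p d d0).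
  by exists N => // k Nk Qk; exists k.
exists k; split=> //; move: pk; rewrite -ball_normE /= distrC => pk.
rewrite (le_lt_trans (enorm_le_norm _))//.
apply: (@le_lt_trans _ _ ((Num.sqrt n%:R + 1) * `|x k - p|)).
  by rewrite ler_wpM2r// lerDl.
by rewrite mulrC -ltr_pdivlMr.
Qed.

End Euclidean.


(** * Convex functions, gradient steps and proximal maps *)

(** Passage to the limit [l -> 0]; the range of [l] is that of a convex combination parameter. *)
Lemma ler_add_small (R : realFieldType) (a b c : R) :
  (forall l, 0 < l < 1 -> a <= b + l * c) -> a <= b.
Proof.
move=> h; apply/ler_addgt0Pr => e e0.
have d0 : 0 < e + `|c| + 1 by rewrite addrAC ltr_wpDr// addr_gt0.
apply: le_trans (h (e / (e + `|c| + 1)) _) _.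
  rewrite divr_gt0//= ltr_pdivrMr// mul1r -addrA ltrDl.
  by rewrite ltr_wpDl.
rewrite lerD2l mulrAC ler_pdivrMr// ler_pM2l//.
by rewrite (le_trans (ler_norm c))// addrAC lerDr addr_ge0// ltW.
Qed.

Section ConvexSmooth.
Set Implicit Arguments.
Unset Strict Implicit.
Context {R : realType} {n : nat}.
Implicit Types (f : 'rV[R]_n -> R) (g : 'rV[R]_n -> 'rV[R]_n) (x y d : 'rV[R]_n).

Lemma has_gradientN f g :
  has_gradient f g -> has_gradient (fun x => - f x) (fun x => - g x).
Proof.
move=> fg x e e0; have [dl dl0 h] := fg x e e0; exists dl => // v /h.
by rewrite -normrN dotpNl !opprD !opprK.
Qed.

Lemma gradient_le f g x d (c : R) : has_gradient f g ->
  (forall l, 0 < l <= 1 -> f (x + l *: d) <= f x + l * c) -> dotp (g x) d <= c.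
Proof.
move=> fg fc; apply/(@ler_add_small _ _ _ (enorm d)) => e /andP[e0 _].
have [dl dl0 h] := fg x e e0.
have dd : 0 < dl + enorm d by rewrite ltr_pwDl// enorm_ge0.
(* This choice gives both [l <= 1] and [enorm (l *: d) < dl], even for [d = 0]. *)
pose l := dl / (dl + enorm d).
have l0 : 0 < l by rewrite divr_gt0.
have l1 : l <= 1 by rewrite ler_pdivrMr// mul1r lerDl enorm_ge0.
have : enorm (l *: d) < dl.
  by rewrite enormZ gtr0_norm// mulrAC ltr_pdivrMr// ltr_pM2l// ltrDr.
move=> /h; rewrite enormZ (gtr0_norm l0) dotpZr ler_norml => /andP[h1 _].
have := fc l; rewrite l0 l1 => /(_ isT) h2.
rewrite -subr_ge0 -(pmulr_rge0 _ l0); lra.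
Qed.

Lemma gradient_ge f g x d (c : R) : has_gradient f g ->
  (forall l, 0 < l <= 1 -> f x + l * c <= f (x + l *: d)) -> c <= dotp (g x) d.
Proof.
move=> /has_gradientN fg fc; rewrite -lerN2 -dotpNl.
apply: (gradient_le fg) => l /fc; rewrite mulrN -opprD lerN2; exact.
Qed.

Lemma convex_gradient f g x y : convex_fun f -> has_gradient f g ->
  f x + dotp (g x) (y - x) <= f y.
Proof.
move=> cf fg; rewrite addrC -lerBrDr; apply: (gradient_le fg) => l /andP[l0 l1].
have := cf y x l; rewrite l1 (ltW l0) => /(_ isT).
have -> : l *: y + (1 - l) *: x = x + l *: (y - x).
  by apply/rowP => i; rewrite !mxE; ring.
lra.
Qed.

Lemma convex_gradient_monotone f g x y : convex_fun f -> has_gradient f g ->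
  0 <= dotp (g x - g y) (x - y).
Proof.
move=> cf fg; have := convex_gradient x y cf fg; have := convex_gradient y x cf fg.
rewrite !dotpE; lra.
Qed.

Lemma dotp_lipschitz (L : R) g x y : lipschitz_with L g ->
  dotp (g x - g y) (x - y) <= L * enorm (x - y) ^+ 2.
Proof.
move=> lg; apply: le_trans (dotp_le _ _) _.
by rewrite expr2 mulrA ler_wpM2r ?enorm_ge0.
Qed.

(** * Co-coercivity of gradients from a one-sided bound (Baillon-Haddad) *)

Section Cocoercivity.
Variables (f : 'rV[R]_n -> R) (g : 'rV[R]_n -> 'rV[R]_n) (M : R).
Hypotheses (cf : convex_fun f) (fg : has_gradient f g).
Hypothesis gM : forall x y, dotp (g x - g y) (x - y) <= M * enorm (x - y) ^+ 2.

(* Bisecting [x, y] turns a constant [C] into [C / 2 + M / 4], whose fixed point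
   is [M / 2]; convexity gives the initial constant [M]. *)
Lemma descent x y :
  f y <= f x + dotp (g x) (y - x) + M / 2 * enorm (y - x) ^+ 2.
Proof.
have bisect j u v : f v <= f u + dotp (g u) (v - u)
                          + M / 2 * (1 + 1 / 2 ^+ j) * enorm (v - u) ^+ 2.
  elim: j u v => [|j IH] u v.
    rewrite expr0; have := convex_gradient v u cf fg; have := gM v u.
    rewrite !sqr_enorm !dotpE; lra.
  pose m := u + 2^-1 *: (v - u).
  have mu : m - u = 2^-1 *: (v - u) by rewrite addrC addKr.
  have vm : v - m = 2^-1 *: (v - u).
    by apply/rowP => i; rewrite !mxE; field.
  have := IH u m; have := IH m v; have := gM m u.
  rewrite mu vm (exprS 2) !sqr_enorm.
  have -> : 1 / (2 * 2 ^+ j) = 2^-1 * (1 / 2 ^+ j) :> R.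
    by field; rewrite expf_neq0//= pnatr_eq0.
  set q := 1 / 2 ^+ j; rewrite !(dotpDl, dotpZl, dotpZr, dotpNl).
  move: (dotp (v - u) (v - u)) (dotp (g u) (v - u)) (dotp (g m) (v - u)) => a b c.
  lra.
apply: (@ler_add_small _ _ _ (`|M| / 2 * enorm (y - x) ^+ 2)) => l /andP[l0 _].
have [j _ /(_ j (leqnn j)) jl] := near_infty_natSinv_expn_lt (PosNum l0).
apply: le_trans (bisect j x y) _.
have {}jl : 1 / 2 ^+ j <= l by exact: ltW.
rewrite mulrDr mulr1 mulrDl addrA lerD2l [leRHS]mulrA; apply: ler_wpM2r.
  exact: sqr_ge0.
apply: (@le_trans _ _ (`|M| / 2 * (1 / 2 ^+ j))).
  by rewrite ler_wpM2r ?divr_ge0 ?exprn_ge0// ler_wpM2r// ler_norm.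
by rewrite mulrC ler_wpM2r// divr_ge0.
Qed.

(** At the gradient step [z = y - w / M], compare the tangent bound from [x] below with the descent
    bound from [y] above. *)
Lemma descent_cocoercive x y : 0 < M ->
  enorm (g y - g x) ^+ 2 / (2 * M) <= f y - f x - dotp (g x) (y - x).
Proof.
move=> M0; pose w := g y - g x; pose z := y - M^-1 *: w.
have := descent y z; have := convex_gradient x z cf fg.
have -> : z - y = - (M^-1 *: w) by rewrite addrC addKr.
have -> : z - x = (y - x) - M^-1 *: w by rewrite addrAC.
rewrite enormN !sqr_enorm !(dotpDr (y - x), dotpNr, dotpZr, dotpZl) -/w.
have -> : dotp (g y) w = dotp w w + dotp (g x) w by rewrite -dotpDl subrK.
have -> : dotp w w / (2 * M) = M^-1 * dotp w w / 2 by field; rewrite gt_eqF.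
have -> : M / 2 * (M^-1 * (M^-1 * dotp w w)) = M^-1 * dotp w w / 2.
  by field; rewrite gt_eqF.
lra.
Qed.

Lemma cocoercive_gt0 x y : 0 < M ->
  enorm (g x - g y) ^+ 2 <= M * dotp (g x - g y) (x - y).
Proof.
move=> M0; rewrite mulrC -ler_pdivrMr//.
have := descent_cocoercive x y M0; have := descent_cocoercive y x M0.
rewrite (enormBC (g y)).
have -> a : a / (2 * M) = a / M / 2 by field; rewrite gt_eqF.
rewrite !dotpE; lra.
Qed.

End Cocoercivity.

(** The case [M = 0] is reached as the limit of [M + l]; it occurs below, where [M = L - mu] may
    vanish. *)
Lemma cocoercive f g (M : R) x y : convex_fun f -> has_gradient f g ->
  (forall x y, dotp (g x - g y) (x - y) <= M * enorm (x - y) ^+ 2) -> 0 <= M ->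
  enorm (g x - g y) ^+ 2 <= M * dotp (g x - g y) (x - y).
Proof.
move=> cf fg gM M0; apply: (@ler_add_small _ _ _ (dotp (g x - g y) (x - y))).
move=> l /andP[l0 _]; rewrite -mulrDl.
apply: (cocoercive_gt0 cf fg); last by rewrite ltr_wpDl.
move=> u v; rewrite mulrDl (le_trans (gM u v))// lerDl.
by rewrite mulr_ge0 ?sqr_ge0 ?ltW.
Qed.

(** With [d = x - y] and [w] the difference of gradients, co-coercivity and [t * L <= 1] give
    [t |w|^2 <= <w, d>], which absorbs the quadratic term of [|d - t w|^2]. *)
Lemma gradient_step_nonexpansive f g (L t : R) : convex_fun f ->
  has_gradient f g -> 0 < L -> lipschitz_with L g -> 0 < t <= 1 / L ->
  lipschitz_with 1 (fun x => x - t *: g x).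
Proof.
move=> cf fg L0 lg /andP[t0 tL] x y; rewrite mul1r.
rewrite -(ler_pXn2r (ltn0Sn 1)) ?nnegrE ?enorm_ge0//.
have := cocoercive x y cf fg (fun x y => dotp_lipschitz x y lg) (ltW L0).
have p0 := convex_gradient_monotone x y cf fg.
have -> : x - t *: g x - (y - t *: g y) = (x - y) - t *: (g x - g y).
  by apply/rowP => i; rewrite !mxE; ring.
rewrite !sqr_enorm; move: (g x - g y) (x - y) p0 => w d p0 ww; rewrite !dotpE (dotpC d w).
have tw : t * dotp w w <= dotp w d.
  apply: le_trans (ler_wpM2l (ltW t0) ww) _; rewrite mulrA.
  by rewrite ler_piMl// -ler_pdivlMr.
have := ler_wpM2l (ltW t0) tw; have := mulr_ge0 (ltW t0) p0; lra.
Qed.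

Lemma strongly_convex_shift (mu : R) f : strongly_convex_fun mu f ->
  convex_fun (fun x => f x - mu / 2 * enorm x ^+ 2).
Proof. by move=> sf x y l /(sf x y); rewrite sqr_enorm_convex; lra. Qed.

Lemma has_gradient_shift (mu : R) f g : 0 < mu -> has_gradient f g ->
  has_gradient (fun x => f x - mu / 2 * enorm x ^+ 2) (fun x => g x - mu *: x).
Proof.
(* Half of [e] serves [f]; the other half covers the remainder [mu / 2 |v|^2], since
   [|v| <= e / mu]. *)
move=> mu0 fg x e e0; have [|dl dl0 h] := fg x (e / 2); first by rewrite divr_gt0.
exists (Num.min dl (e / mu)); first by rewrite lt_min dl0 divr_gt0.
move=> v; rewrite lt_min => /andP[/h hv]; rewrite ltr_pdivlMr// => /ltW ve.
have -> : f (x + v) - mu / 2 * enorm (x + v) ^+ 2 - (f x - mu / 2 * enorm x ^+ 2)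
    - dotp (g x - mu *: x) v
  = f (x + v) - f x - dotp (g x) v - mu / 2 * enorm v ^+ 2.
  by rewrite !sqr_enorm !dotpE (dotpC v x); field.
apply: le_trans (ler_normB _ _) _.
have -> : e * enorm v = e / 2 * enorm v + e / 2 * enorm v by field.
apply: lerD hv _.
have m0 : 0 <= mu / 2 * enorm v ^+ 2.
  by rewrite mulr_ge0 ?sqr_ge0// divr_ge0// ltW.
by rewrite (ger0_norm m0); have := ler_wpM2r (enorm_ge0 v) ve; lra.
Qed.

Lemma strongly_convex_gradient (mu : R) f g x y : 0 < mu ->
  strongly_convex_fun mu f -> has_gradient f g ->
  f x + dotp (g x) (y - x) + mu / 2 * enorm (y - x) ^+ 2 <= f y.
Proof.
move=> mu0 /strongly_convex_shift sf /(has_gradient_shift mu0) fg.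
have := convex_gradient x y sf fg.
rewrite !sqr_enorm !dotpE (dotpC y x); lra.
Qed.

(* The co-coercivity estimate behind this is that of [f - mu / 2 |.|^2], whose
   gradient is monotone with upper constant [L - mu]. *)
Lemma gradient_step_contraction f g (mu L u : R) : 0 < mu ->
  strongly_convex_fun mu f -> has_gradient f g -> 0 < L -> lipschitz_with L g ->
  0 < u <= 2 / (L + mu) ->
  lipschitz_with (Num.sqrt (1 - 2 * u * mu * L / (mu + L))) (fun x => x - u *: g x).
Proof.
move=> mu0 sf fg L0 lg /andP[u0 uL] x y.
have mL : 0 < mu + L by rewrite addr_gt0.
set c := 1 - _; rewrite -(ler_pXn2r (ltn0Sn 1)) ?nnegrE ?mulr_ge0 ?enorm_ge0 ?sqrtr_ge0//.
rewrite exprMn; apply: (@le_trans _ _ (c * enorm (x - y) ^+ 2)); last first.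
  apply: ler_wpM2r; first exact: sqr_ge0.
  (* The square root of a nonpositive number is 0 by convention, so only [c <= (sqrt c)^2] is
     available at this stage. *)
  by have [c0|/ltW/sqr_sqrtr->//] := leP c 0; rewrite ler0_sqrtr// expr0n.
pose h z := g z - mu *: z.
have ch := strongly_convex_shift sf; have gh := has_gradient_shift mu0 fg.
have hE z w : dotp (h z - h w) (z - w) = dotp (g z - g w) (z - w) - mu * dotp (z - w) (z - w).
  by rewrite /h !dotpE; ring.
have hM z w : dotp (h z - h w) (z - w) <= (L - mu) * enorm (z - w) ^+ 2.
  rewrite hE -sqr_enorm mulrBl lerD2r; exact: dotp_lipschitz.
have [/eqP|xy] := eqVneq (x - y) 0.
  by rewrite subr_eq0 => /eqP->; rewrite !subrr enorm0 expr0n mulr0.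
(* Monotonicity of [h] and its upper bound force [mu <= L], but only at two distinct points, hence
   the case split just made. *)
have Lmu : 0 <= L - mu.
  have xy0 : 0 < enorm (x - y) ^+ 2.
    by rewrite exprn_gt0// lt_def enorm_ge0 andbT; apply: contra_neq xy => /enorm_eq0.
  rewrite -(pmulr_lge0 _ xy0).
  exact: le_trans (convex_gradient_monotone x y ch gh) (hM x y).
have := cocoercive x y ch gh hM Lmu; rewrite -/(h x) -/(h y) hE.
have -> : h x - h y = (g x - g y) - mu *: (x - y).
  by apply/rowP => i; rewrite !mxE; ring.
have -> : x - u *: g x - (y - u *: g y) = (x - y) - u *: (g x - g y).
  by apply/rowP => i; rewrite !mxE; ring.
rewrite !sqr_enorm.
move: (g x - g y) (x - y) => w d.
rewrite !(dotpDl, dotpDr, dotpNl, dotpNr, dotpZl, dotpZr) (dotpC d w) => wd.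
have wd' : (dotp w w + mu * L * dotp d d) / (mu + L) <= dotp w d.
  by rewrite ler_pdivrMr//; lra.
have uw : u * dotp w w <= 2 / (L + mu) * dotp w w by rewrite ler_wpM2r ?dotp_ge0.
have := ler_wpM2l (ltW u0) wd'; have := ler_wpM2l (ltW u0) uw.
have -> : c = 1 - 2 * (u * (mu * L / (mu + L))) by rewrite /c; field; rewrite gt_eqF.
rewrite (addrC L).
have -> : (dotp w w + mu * L * dotp d d) / (mu + L)
  = dotp w w / (mu + L) + mu * L / (mu + L) * dotp d d.
  by field; rewrite gt_eqF.
have -> : 2 / (mu + L) * dotp w w = 2 * (dotp w w / (mu + L)) by field; rewrite gt_eqF.
move: (dotp w w / _) (mu * L / _) => a b; lra.
Qed.

End ConvexSmooth.

(** * Proximal maps and the forward-backward operator *)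

Section Prox.
Set Implicit Arguments.
Unset Strict Implicit.
Context {R : realType} {n : nat}.
Implicit Types (g : 'rV[R]_n -> \bar R) (x y p q : 'rV[R]_n).

Lemma prox_fin_num (c : R) g x p : 0 < c -> proper_efun g ->
  is_prox c g x p -> g p \is a fin_num.
Proof.
move=> c0 [[z gz] gy] /(_ z) /=.
have /fineK <- : g z \is a fin_num by rewrite fin_numE (gt_eqF (gy z)) (lt_eqF gz).
rewrite fin_numE (gt_eqF (gy p))/= -EFinM -EFinD.
by case: (g p) => //; rewrite gt0_muley ?lte_fin// addye// leye_eq.
Qed.

(** This says that [(x - p) / c] is a subgradient of [g] at [p]. Minimality is tested at
    [p + l (q - p)]; after division by [l] the quadratic remainder vanishes with [l]. *)
Lemma prox_variational (c : R) g x p q (a b : R) : 0 < c -> convex_efun g ->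
  is_prox c g x p -> g p = a%:E -> g q = b%:E ->
  c * a <= c * b + dotp (p - x) (q - p).
Proof.
move=> c0 cg gx gp gq; apply: (@ler_add_small _ _ _ (enorm (q - p) ^+ 2 / 2)).
move=> l /[dup] /andP[l0 l1] /(cg q p) /=.
have := gx (l *: q + (1 - l) *: p) => /=; rewrite gp gq -!EFinM -!EFinD.
have -> : l *: q + (1 - l) *: p - x = (p - x) + l *: (q - p).
  by apply/rowP => i; rewrite !mxE; ring.
(* At the intermediate point, [+oo] is excluded by convexity and [-oo] by minimality of [p]. *)
case: (g _) => [r| |]; rewrite ?leye_eq//; last first.
  by rewrite gt0_muleNy ?lte_fin// addNye leeNy_eq.
rewrite -EFinM -EFinD !lee_fin !sqr_enorm => h1 h2.
have := ler_wpM2l (ltW c0) h2.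
move: h1; rewrite !(dotpDl (p - x), dotpDr (p - x), dotpZl, dotpZr) (dotpC (q - p) (p - x)).
move: (dotp (p - x) (q - p)) (dotp (q - p) (q - p)) (dotp (p - x) (p - x)) => A B C h1 h3.
rewrite -subr_ge0 -(pmulr_rge0 _ l0); lra.
Qed.

(** Adding the variational inequalities at [x] and [y] gives firm nonexpansiveness; Cauchy-Schwarz
    concludes. *)
Lemma prox_nonexpansive (c : R) g (prox : 'rV[R]_n -> 'rV[R]_n) : 0 < c ->
  proper_efun g -> convex_efun g -> (forall z, is_prox c g z (prox z)) ->
  lipschitz_with 1 prox.
Proof.
move=> c0 pg cg hp x y; rewrite mul1r.
have gE z : g (prox z) = (fine (g (prox z)))%:E.
  by rewrite fineK// (prox_fin_num c0 pg (hp z)).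
have := prox_variational c0 cg (hp x) (gE x) (gE y).
have := prox_variational c0 cg (hp y) (gE y) (gE x).
move: (fine _) (fine _) => a b h1 h2.
have : enorm (prox x - prox y) ^+ 2 <= dotp (prox x - prox y) (x - y).
  move: h1 h2; rewrite !sqr_enorm !dotpE (dotpC (prox x) y) (dotpC (prox x) x).
  rewrite (dotpC (prox y) x) (dotpC (prox y) y) (dotpC (prox y) (prox x)); lra.
move=> /le_trans/(_ (dotp_le _ _)); rewrite expr2.
have := enorm_ge0 (prox x - prox y); rewrite le_eqVlt => /orP[/eqP<-|p0].
  by rewrite enorm_ge0.
by rewrite ler_pM2l.
Qed.

Lemma forward_backward_nonexpansive f gf (L t : R) g (prox : 'rV[R]_n -> 'rV[R]_n) :
  convex_fun f -> has_gradient f gf -> 0 < L -> lipschitz_with L gf ->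
  0 < t <= 1 / L -> proper_efun g -> convex_efun g ->
  (forall z, is_prox t g z (prox z)) ->
  lipschitz_with 1 (fun z => prox (z - t *: gf z)).
Proof.
move=> cf fg L0 lg tL pg cg hp x y; have t0 : 0 < t by case/andP: tL.
rewrite (le_trans (prox_nonexpansive t0 pg cg hp _ _))//.
by rewrite mul1r (gradient_step_nonexpansive cf fg L0 lg tL).
Qed.

End Prox.


(** * Hierarchical fixed points and their variational inequalities *)

Section RealSequences.
Set Implicit Arguments.
Unset Strict Implicit.
Context {R : realType}.
Implicit Types (a alpha v : R^nat) (c M : R).

(* As long as [a] stays above [e] it loses at least [c * alpha k * e / 2] at each
   step; once it is below [e] it stays there. *)
Lemma recursive_inequality_cvg0 a alpha c : 0 < c <= 1 ->
  (forall k, 0 <= a k) -> (forall k, 0 <= alpha k <= 1) ->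
  series alpha @ \oo --> +oo ->
  (forall e : R, 0 < e ->
    \forall k \near \oo, a k.+1 <= (1 - c * alpha k) * a k + alpha k * e) ->
  forall e : R, 0 < e -> \forall k \near \oo, a k <= e.
Proof.
move=> /andP[c0 c1] a0 alpha01 salpha ha e e0.
(* Half of the contraction gain is granted to the error, leaving the other half as net loss. *)
have ce : 0 < c * e / 2 by rewrite divr_gt0 ?mulr_gt0.
have [N _ hN] := ha _ ce.
have stay k : (N <= k)%N -> a k <= e -> a k.+1 <= e.
  move=> Nk ak; apply: le_trans (hN k Nk) _; have /andP[al0 al1] := alpha01 k.
  have ca1 : 0 <= 1 - c * alpha k by rewrite subr_ge0 mulr_ile1// ltW.
  have := ler_wpM2l ca1 ak; have := mulr_ge0 (mulr_ge0 (ltW c0) al0) (ltW e0); lra.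
have [[m Nm am]|none] := pselect (exists2 m, (N <= m)%N & a m <= e).
  exists m => // k /= mk; rewrite -(subnKC mk).
  elim: (k - m)%N => [|j IH]; first by rewrite addn0.
  by rewrite addnS stay// (leq_trans Nm)// leq_addr.
have drop j : a (N + j)%N + c * e / 2 * series alpha (N + j)%N <=
              a N + c * e / 2 * series alpha N.
  elim: j => [|j IH]; first by rewrite addn0.
  apply: le_trans IH; rewrite addnS seriesSr.
  have := hN (N + j)%N (leq_addr _ _).
  have : e <= a (N + j)%N.
    by rewrite leNgt; apply/negP => aj; apply: none; exists (N + j)%N; rewrite ?leq_addr// ltW.
  move=> ea; have /andP[al0 _] := alpha01 (N + j)%N.
  have := ler_wpM2l (mulr_ge0 (ltW c0) al0) ea; lra.
(* Since [a] is nonnegative, [drop] would bound the divergent series. *)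
have := cvgry_gt salpha ((a N + c * e / 2 * series alpha N) / (c * e / 2)).
move=> [m _ /(_ (N + m)%N (leq_addl _ _))]; rewrite ltr_pdivrMr//.
have := drop m; have := a0 (N + m)%N; lra.
Qed.

Lemma limn_esup_lt_near v M :
  (limn_esup (fun k => (v k)%:E) < M%:E)%E -> \forall k \near \oo, v k < M.
Proof.
move=> /ereal_inf_lt[_ [A [N _ NA] <-] AM]; exists N => // k /NA Ak.
by rewrite -lte_fin (le_lt_trans _ AM)//; apply: ereal_sup_ubound; exists k.
Qed.

Lemma limn_esup_lty_near v :
  (limn_esup (fun k => (v k)%:E) < +oo)%E ->
  exists2 M, 0 < M & \forall k \near \oo, v k < M.
Proof.
move=> vy; suff [M vM] : exists M : R, (limn_esup (fun k => (v k)%:E) < M%:E)%E.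
  exists (`|M| + 1); first by rewrite ltr_wpDl.
  apply: limn_esup_lt_near; apply: lt_le_trans vM _.
  by rewrite lee_fin (le_trans (ler_norm M))// lerDl.
(* The upper limit may also be [-oo]; any real bound then works. *)
move: vy; case: (limn_esup _) => [l _| |_]; last by exists 0; rewrite ltNyr.
  by exists (l + 1); rewrite lte_fin ltrDl.
by rewrite ltxx.
Qed.

End RealSequences.

(** * The variational inequality of [I - T] over the fixed points of [W] *)

Section HierarchicalFixedPoints.
Set Implicit Arguments.
Unset Strict Implicit.
Context {R : realType} {n : nat}.
Implicit Types (T W : 'rV[R]_n -> 'rV[R]_n) (x y z p : 'rV[R]_n).

Definition hierarchical_fixpoints T W : set 'rV[R]_n :=
  [set z | fixpoints W z /\ forall y, fixpoints W y -> 0 <= dotp (z - T z) (y - z)].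

Lemma lipschitz_bounded (L : R) T (x : nat -> 'rV[R]_n) (M : R) :
  0 <= L -> lipschitz_with L T -> (forall k, enorm (x k) <= M) ->
  exists2 B, 0 < B & forall k, enorm (T (x k)) <= B.
Proof.
move=> L0 LT xM; have M0 : 0 <= M := le_trans (enorm_ge0 _) (xM 0%N).
exists (L * M + enorm (T 0) + 1).
  by rewrite ltr_wpDl// addr_ge0 ?enorm_ge0// mulr_ge0.
move=> k; rewrite -[T (x k)](subrK (T 0)) (le_trans (enormD _ _))//.
apply: ler_wpDr => //; rewrite lerD2r (le_trans (LT _ _))// subr0.
exact: ler_wpM2l.
Qed.

Lemma nonexpansive_complement_monotone T x y : lipschitz_with 1 T ->
  0 <= dotp ((x - T x) - (y - T y)) (x - y).
Proof.
move=> LT; have := dotp_lipschitz x y LT.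
rewrite mul1r sqr_enorm !dotpE; lra.
Qed.

(** [W z] is no farther from [x] and from [y] than [z] is. Since [sqr_enorm_convex] is an equality,
    comparing it for [W z] and for [z] leaves [|W z - z|^2 <= 0]. *)
Lemma fixpoints_convex W x y (l : R) : lipschitz_with 1 W -> 0 <= l <= 1 ->
  fixpoints W x -> fixpoints W y -> fixpoints W (l *: x + (1 - l) *: y).
Proof.
move=> LW /andP[l0 l1] Wx Wy; set z := (X in fixpoints W X).
apply/eqP; rewrite -subr_eq0; apply/eqP/enorm_eq0/eqP.
rewrite -sqrf_eq0 eq_le sqr_ge0 andbT.
have nearer p : fixpoints W p -> enorm (W z - p) ^+ 2 <= enorm (z - p) ^+ 2.
  move=> Wp; rewrite ler_pXn2r ?nnegrE ?enorm_ge0//.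
  by have := LW z p; rewrite mul1r Wp.
have -> : W z - z = l *: (W z - x) + (1 - l) *: (W z - y).
  by apply/rowP => i; rewrite !mxE; ring.
have h0 : 0 <= 1 - l by rewrite subr_ge0.
have := ler_wpM2l l0 (nearer x Wx); have := ler_wpM2l h0 (nearer y Wy).
have : enorm (l *: (z - x) + (1 - l) *: (z - y)) ^+ 2 = 0.
  rewrite (_ : _ + _ = 0) ?enorm0 ?expr0n//.
  by apply/rowP => i; rewrite !mxE; ring.
rewrite !sqr_enorm_convex.
have -> : W z - x - (W z - y) = y - x by apply/rowP => i; rewrite !mxE; ring.
have -> : z - x - (z - y) = y - x by apply/rowP => i; rewrite !mxE; ring.
lra.
Qed.

(** Minty's form is affine in [z] and free of [T z], so convexity and closedness become visible. One
    direction is monotonicity of [I - T]; the other tests at [w] between [z] and [y] and lets [w]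
    tend to [z]. *)
Lemma hierarchical_fixpoints_minty T W z : lipschitz_with 1 T -> lipschitz_with 1 W ->
  hierarchical_fixpoints T W z <->
  fixpoints W z /\ forall y, fixpoints W y -> 0 <= dotp (y - T y) (y - z).
Proof.
move=> LT LW; split=> -[Wz hz]; split=> // y Wy.
  have := hz y Wy; have := nonexpansive_complement_monotone y z LT.
  rewrite (dotpDl (y - T y)) dotpNl; lra.
(* The constant comes from [I - T] being 2-Lipschitz and [w - z = l (y - z)]. *)
rewrite -lerN2 oppr0; apply: (@ler_add_small _ _ _ (2 * enorm (y - z) ^+ 2)).
move=> l /andP[l0 l1]; pose w := l *: y + (1 - l) *: z.
have wz : w - z = l *: (y - z) by apply/rowP => i; rewrite !mxE; ring.
have /hz : fixpoints W w by apply: fixpoints_convex => //; rewrite !ltW.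
rewrite wz dotpZr (pmulr_rge0 _ l0) => h.
have -> : z - T z = (w - T w) - ((w - z) - (T w - T z)).
  by apply/rowP => i; rewrite !mxE; ring.
rewrite (dotpDl (w - T w)) dotpNl opprD opprK.
have : dotp (w - z - (T w - T z)) (y - z) <= l * (2 * enorm (y - z) ^+ 2).
  apply: le_trans (dotp_le _ _) _; rewrite expr2 !mulrA ler_wpM2r ?enorm_ge0//.
  apply: le_trans (enormD _ _) _; rewrite enormN.
  have := LT w z; rewrite mul1r wz enormZ gtr0_norm//; lra.
lra.
Qed.

Lemma hierarchical_fixpoints_convex T W x y (l : R) :
  lipschitz_with 1 T -> lipschitz_with 1 W -> 0 <= l <= 1 ->
  hierarchical_fixpoints T W x -> hierarchical_fixpoints T W y ->
  hierarchical_fixpoints T W (l *: x + (1 - l) *: y).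
Proof.
move=> LT LW l01; rewrite !hierarchical_fixpoints_minty// => -[Wx hx] [Wy hy].
split=> [|z Wz]; first exact: fixpoints_convex.
have -> : z - (l *: x + (1 - l) *: y) = l *: (z - x) + (1 - l) *: (z - y).
  by apply/rowP => i; rewrite !mxE; ring.
case/andP: l01 => l0 l1.
by rewrite dotpDr !dotpZr addr_ge0// mulr_ge0 ?subr_ge0 ?hx ?hy.
Qed.

(** Closedness in a form that does not ask the approximating points to lie in the set, so that it
    applies to iterates as well as to minimizing sequences. *)
Lemma hierarchical_fixpoints_approx T W p : lipschitz_with 1 T -> lipschitz_with 1 W ->
  (forall e, 0 < e -> exists2 x, enorm (x - p) < e & enorm (x - W x) <= e) ->
  (forall y e, fixpoints W y -> 0 < e ->
    exists2 x, enorm (x - p) < e & dotp (y - T y) (x - y) <= e) ->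
  hierarchical_fixpoints T W p.
Proof.
move=> LT LW hW hT; apply/hierarchical_fixpoints_minty => //; split=> [|y Wy].
  apply/eqP; rewrite -subr_eq0; apply/eqP/enorm_eq0/eqP.
  rewrite eq_le enorm_ge0 andbT; apply: (@ler_add_small _ _ _ 3) => e /andP[e0 _].
  have [x xp xW] := hW e e0; rewrite add0r enormBC.
  apply: le_trans (enorm_triangle x _ _) _.
  have := enorm_triangle (W x) x (W p); have := LW x p.
  rewrite mul1r (enormBC p); lra.
rewrite -lerN2 oppr0 -dotpNr opprB.
apply: (@ler_add_small _ _ _ (1 + enorm (y - T y))) => e /andP[e0 _].
have [x xp xT] := hT y e Wy e0.
have -> : p - y = (p - x) + (x - y) by rewrite subrKA.
rewrite dotpDr; have := dotp_le (y - T y) (p - x).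
rewrite (enormBC p); have := ler_wpM2l (enorm_ge0 (y - T y)) (ltW xp); lra.
Qed.

(** Direct method: quadratic growth of [om] bounds a minimizing sequence, a cluster point is a
    minimizer, and the inequality is its first-order condition along segments. *)
Lemma hierarchical_vi_exists T W om gom (mu : R) :
  lipschitz_with 1 T -> lipschitz_with 1 W ->
  0 < mu -> strongly_convex_fun mu om -> has_gradient om gom ->
  hierarchical_fixpoints T W !=set0 ->
  exists2 p, hierarchical_fixpoints T W p &
    forall z, hierarchical_fixpoints T W z -> 0 <= dotp (gom p) (z - p).
Proof.
move=> LT LW mu0 som gomP [z0 Oz0].
have lower z : om z0 - enorm (gom z0) * enorm (z - z0) + mu / 2 * enorm (z - z0) ^+ 2 <= om z.
  have := strongly_convex_gradient z0 z mu0 som gomP.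
  have := dotp_norm (gom z0) (z - z0); rewrite ler_norml => /andP[]; lra.
pose E := om @` hierarchical_fixpoints T W.
have infE : has_inf E.
  split; first by exists (om z0), z0.
  exists (om z0 - enorm (gom z0) ^+ 2 / (2 * mu)) => _ [z _ <-].
  apply: le_trans (lower z).
  have : 0 <= (enorm (gom z0) - mu * enorm (z - z0)) ^+ 2 / (2 * mu).
    by rewrite divr_ge0 ?sqr_ge0// mulr_ge0// ltW.
  have -> : (enorm (gom z0) - mu * enorm (z - z0)) ^+ 2 / (2 * mu)
    = enorm (gom z0) ^+ 2 / (2 * mu) - enorm (gom z0) * enorm (z - z0)
      + mu / 2 * enorm (z - z0) ^+ 2.
    by field; rewrite gt_eqF.
  lra.
have /choice[y yP] k : exists z, hierarchical_fixpoints T W z /\ om z < inf E + k.+1%:R^-1.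
  by have [|_ [z Oz <-] zE] := inf_adherent (_ : 0 < k.+1%:R^-1) infE; [|exists z].
have infz0 : inf E <= om z0 by apply: ge_inf; [exact: infE.2|exists z0].
(* Beyond distance [B] from [z0], [lower] gives [om z > om z0 + 1], too large for the minimizing
   sequence. *)
pose B := 1 + 2 * (1 + enorm (gom z0)) / mu.
have yB k : enorm (y k) <= B + enorm z0.
  rewrite -[y k](subrK z0) (le_trans (enormD _ _))// lerD2r leNgt.
  apply/negP => yfar; have [_ yk] := yP k; have := lower (y k).
  have k1 : k.+1%:R^-1 <= 1 :> R by rewrite invf_le1// ler1n.
  have D1 : 1 < enorm (y k - z0).
    apply: le_lt_trans yfar; rewrite lerDl divr_ge0 ?(ltW mu0)//.
    by rewrite mulr_ge0// addr_ge0// enorm_ge0.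
  have DG : 2 * (1 + enorm (gom z0)) <= enorm (y k - z0) * mu.
    by rewrite -ler_pdivrMr// (le_trans _ (ltW yfar))// lerDr.
  have := ler_wpM2r (enorm_ge0 (y k - z0)) DG; rewrite expr2.
  move: (k.+1%:R^-1) k1 yk => i k1 yk; lra.
have [|p hp] := bolzano_weierstrass_along (Q := fun _ => True) yB.
  by move=> N; exists N.
have Op : hierarchical_fixpoints T W p.
  apply: hierarchical_fixpoints_approx => // [e e0|v e Wv e0];
    have [k [_ _ kp]] := hp e e0 0%N; exists (y k) => //;
    have [/(hierarchical_fixpoints_minty _ LT LW)[Wy hy] _] := yP k.
    by rewrite Wy subrr enorm0 ltW.
  by have := hy v Wv; rewrite -[v - y k]opprB dotpNr; lra.
(* The tangent of [om] at [p] supplies the lower semicontinuity needed here. *)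
have pmin : om p <= inf E.
  apply: (@ler_add_small _ _ _ (1 + enorm (gom p))) => l /andP[l0 _].
  have [N _ hN] := near_infty_natSinv_lt (PosNum l0).
  have [k [/hN kl _ kp]] := hp l l0 N; have [_ yk] := yP k.
  have {}kl : k.+1%:R^-1 <= l by exact: ltW.
  have := strongly_convex_gradient p (y k) mu0 som gomP.
  have := dotp_norm (gom p) (y k - p); rewrite ler_norml => /andP[h _].
  have := ler_wpM2l (enorm_ge0 (gom p)) (ltW kp).
  have : 0 <= mu / 2 * enorm (y k - p) ^+ 2.
    by rewrite mulr_ge0 ?sqr_ge0// divr_ge0// ltW.
  move: (k.+1%:R^-1) kl yk => i kl yk; lra.
exists p => // z Oz; apply: (gradient_ge gomP) => l /andP[l0 l1].
rewrite mulr0 addr0 (le_trans pmin)//; apply: ge_inf; first exact: infE.2.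
exists (p + l *: (z - p)) => //.
have -> : p + l *: (z - p) = l *: z + (1 - l) *: p.
  by apply/rowP => i; rewrite !mxE; ring.
by apply: hierarchical_fixpoints_convex => //; rewrite l1 ltW.
Qed.

(** Testing each inequality at the other point and adding yields [|y - x|^2 <= <S y - S x, y - x> <=
    r |y - x|^2]. *)
Lemma contraction_vi_unique (r : R) (S : 'rV[R]_n -> 'rV[R]_n) (A : set 'rV[R]_n) x y :
  r < 1 -> lipschitz_with r S -> A x -> A y ->
  (forall z, A z -> 0 <= dotp (x - S x) (z - x)) ->
  (forall z, A z -> 0 <= dotp (y - S y) (z - y)) -> y = x.
Proof.
move=> r1 LS Ax Ay /(_ y Ay) hx /(_ x Ax) hy.
apply/eqP; rewrite -subr_eq0; apply/eqP/enorm_eq0/eqP.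
rewrite -sqrf_eq0 eq_le sqr_ge0 andbT.
have r0 : 0 < 1 - r by rewrite subr_gt0.
rewrite -(pmulr_rle0 _ r0); have := dotp_lipschitz y x LS.
move: hx hy; rewrite !sqr_enorm !dotpE; lra.
Qed.

(** A near-minimizer replaces the projection onto [A]. Nonemptiness matters, as [inf] of the empty
    set is 0 by default. *)
Lemma dist_approx (A : set 'rV[R]_n) x (d : R) : A !=set0 -> dist x A < d ->
  exists2 q, A q & enorm (x - q) < d.
Proof.
move=> [a Aa] xd; have infE : has_inf [set enorm (x - b) | b in A].
  split; first by exists (enorm (x - a)), a.
  by exists 0 => _ [b _ <-]; exact: enorm_ge0.
have d0 : 0 < d - dist x A by rewrite subr_gt0.
have [_ [q Aq <-] qd] := inf_adherent d0 infE.
by exists q => //; rewrite (lt_le_trans qd)// addrC subrK.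
Qed.

End HierarchicalFixedPoints.


(** * Convergence of the iteration *)

Section TrilevelStep.
Set Implicit Arguments.
Unset Strict Implicit.
Context {R : realType} {n : nat}.
Variables (S T W : 'rV[R]_n -> 'rV[R]_n).
Implicit Types (a b : R) (z w : 'rV[R]_n).

Definition trilevel_step a b z : 'rV[R]_n :=
  a *: S z + ((1 - a) * b) *: T z + ((1 - a) * (1 - b)) *: W z.

(** The three weights sum to 1 and only the first map contracts: [a r + (1 - a) = 1 - (1 - r) a]. *)
Lemma trilevel_step_lipschitz (r a b : R) : lipschitz_with r S ->
  lipschitz_with 1 T -> lipschitz_with 1 W -> 0 <= a <= 1 -> 0 <= b <= 1 ->
  lipschitz_with (1 - (1 - r) * a) (trilevel_step a b).
Proof.
move=> LS LT LW /andP[a0 a1] /andP[b0 b1] z w; rewrite /trilevel_step.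
set p := (1 - a) * b; set q := (1 - a) * (1 - b).
have p0 : 0 <= p by rewrite mulr_ge0// subr_ge0.
have q0 : 0 <= q by rewrite mulr_ge0// subr_ge0.
rewrite (_ : _ - _ = a *: (S z - S w) + p *: (T z - T w) + q *: (W z - W w)).
  have := ler_wpM2l a0 (LS z w); have := ler_wpM2l p0 (LT z w).
  have := ler_wpM2l q0 (LW z w) => hq hp ha.
  apply: le_trans (enormD _ _) _; rewrite enormZ (ger0_norm q0).
  have := enormD (a *: (S z - S w)) (p *: (T z - T w)).
  rewrite !enormZ (ger0_norm p0) (ger0_norm a0).
  have pq : q = 1 - a - p by rewrite /q /p; ring.
  move: hq; rewrite pq; lra.
by apply/rowP => i; rewrite !mxE; ring.
Qed.

Lemma trilevel_step_perturbation (B a b a' b' : R) z :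
  enorm (S z) <= B -> enorm (T z) <= B -> enorm (W z) <= B ->
  0 <= a' <= 1 -> 0 <= b <= 1 ->
  enorm (trilevel_step a' b' z - trilevel_step a b z) <=
    4 * B * (`|b' - b| + `|a' - a|).
Proof.
move=> SB TB WB /andP[a0 a1] /andP[b0 b1].
(* [p] is the change of the weight of [T]; the three changes sum to 0. *)
set p := (1 - a') * (b' - b) - (a' - a) * b.
have -> : trilevel_step a' b' z - trilevel_step a b z
  = (a' - a) *: S z + p *: T z + (- (a' - a) - p) *: W z.
  by apply/rowP => i; rewrite !mxE /p; ring.
have pD : `|p| <= `|b' - b| + `|a' - a|.
  apply: le_trans (ler_normB _ _) _; rewrite !normrM.
  apply: lerD; last by rewrite ler_piMr// ger0_norm.
  by rewrite ler_piMl// ger0_norm ?subr_ge0// gerBl.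
have qD : `|- (a' - a) - p| <= `|a' - a| + `|p|.
  by apply: le_trans (ler_normB _ _) _; rewrite normrN.
have B0 : 0 <= B := le_trans (enorm_ge0 _) SB.
apply: le_trans (enormD _ _) _; rewrite enormZ.
have := enormD ((a' - a) *: S z) (p *: T z); rewrite !enormZ.
have := ler_pM (normr_ge0 _) (enorm_ge0 _) qD WB.
have := ler_wpM2l (normr_ge0 p) TB; have := ler_wpM2l (normr_ge0 (a' - a)) SB.
have := ler_wpM2r B0 pD.
have := mulr_ge0 (normr_ge0 (b' - b)) B0.
lra.
Qed.

End TrilevelStep.

Lemma near_infty_succ (P : set nat) :
  (\forall k \near \oo, P k) -> \forall k \near \oo, P k.+1.
Proof. by move=> [N _ h]; exists N => // k Nk; exact: (h k.+1 (leqW Nk)). Qed.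

Section TrilevelIteration.
Set Implicit Arguments.
Unset Strict Implicit.
Context {R : realType} {n : nat}.
Variables (S T W : 'rV[R]_n -> 'rV[R]_n) (r : R).
Variables (alpha beta : R^nat) (x : nat -> 'rV[R]_n) (M K C : R).
Hypotheses (r01 : 0 <= r < 1) (LS : lipschitz_with r S).
Hypotheses (LT : lipschitz_with 1 T) (LW : lipschitz_with 1 W).
Hypotheses (alpha01 : forall k, 0 < alpha k < 1) (beta01 : forall k, 0 < beta k < 1).
Hypothesis xS : forall k, x k.+1 = trilevel_step S T W (alpha k) (beta k) (x k).
Hypothesis alpha_beta : forall e : R, 0 < e -> \forall k \near \oo, alpha k <= e * beta k.
Hypothesis beta_cvg : forall e : R, 0 < e -> \forall k \near \oo, beta k <= e.
Hypothesis alpha_div : series alpha @ \oo --> +oo.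
Hypothesis K0 : 0 <= K.
Hypothesis invb_var : \forall k \near \oo, `|(beta k)^-1 - (beta k.-1)^-1| <= K * alpha k.
Hypothesis var : forall e : R, 0 < e -> \forall k \near \oo,
  `|beta k - beta k.-1| + `|alpha k - alpha k.-1| <= e * (alpha k * beta k).
Hypothesis xM : forall k, enorm (x k) <= M.
Hypothesis C0 : 0 <= C.
Hypothesis dist_fix : \forall k \near \oo,
  exists2 q, fixpoints W q & enorm (x k.+1 - q) <= C * alpha k.

Let alpha01' k : 0 <= alpha k <= 1.
Proof. by case/andP: (alpha01 k) => a0 a1; rewrite !ltW. Qed.

Let beta01' k : 0 <= beta k <= 1.
Proof. by case/andP: (beta01 k) => b0 b1; rewrite !ltW. Qed.

Let c01 : 0 < 1 - r <= 1.
Proof. by case/andP: r01 => r0 r1; rewrite subr_gt0 r1 gerBl. Qed.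

Let rate_ge0 k : 0 <= 1 - (1 - r) * alpha k.
Proof.
have /andP[a0 a1] := alpha01' k; have /andP[c0 c1] := c01.
by rewrite subr_ge0 mulr_ile1// ltW.
Qed.

Let bound : exists2 B, 0 < B & forall k,
  [/\ enorm (x k) <= B, enorm (S (x k)) <= B, enorm (T (x k)) <= B & enorm (W (x k)) <= B].
Proof.
have [r0 _] := andP r01.
have [BS BS0 hS] := lipschitz_bounded r0 LS xM.
have [BT BT0 hT] := lipschitz_bounded ler01 LT xM.
have [BW BW0 hW] := lipschitz_bounded ler01 LW xM.
have M0 : 0 <= M := le_trans (enorm_ge0 _) (xM 0%N).
exists (M + BS + BT + BW); first lra.
by move=> k; split; [have := xM k|have := hS k|have := hT k|have := hW k]; lra.
Qed.

Let step_variation : exists2 B, 0 < B & forall k, (0 < k)%N ->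
  enorm (x k.+1 - x k) <= (1 - (1 - r) * alpha k) * enorm (x k - x k.-1)
    + B * (`|beta k - beta k.-1| + `|alpha k - alpha k.-1|).
Proof.
have [B B0 hB] := bound; exists (4 * B); first by rewrite mulr_gt0.
case=> // k _; rewrite /= [in x k.+2]xS {2}[x k.+1]xS.
set G := trilevel_step S T W.
(* The intermediate point has the new parameters and the old iterate: one part is contraction, the
   other parameter variation. *)
apply: le_trans (enorm_triangle (G (alpha k.+1) (beta k.+1) (x k)) _ _) _.
have [_ SB TB WB] := hB k.
by apply: lerD; [exact: trilevel_step_lipschitz|exact: trilevel_step_perturbation].
Qed.

Let varB (B e : R) : 0 < B -> 0 < e -> \forall k \near \oo,
  B * (`|beta k - beta k.-1| + `|alpha k - alpha k.-1|) <= e * (alpha k * beta k).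
Proof.
move=> B0 e0; apply: filterS (var (divr_gt0 e0 B0)) => k.
by rewrite [e / B * _]mulrAC ler_pdivlMr// mulrC.
Qed.

(** The parameter variation is [o(alpha k * beta k)], in particular [o(alpha k)], as the recursion
    requires. *)
Lemma trilevel_increments_cvg0 (e : R) : 0 < e ->
  \forall k \near \oo, enorm (x k - x k.-1) <= e.
Proof.
have [B B0 hB] := step_variation; move: e.
apply: (recursive_inequality_cvg0 c01 _ alpha01' alpha_div) => // [k|d d0].
  exact: enorm_ge0.
apply: filterS2 (nbhs_infty_gt 0%N) (varB B0 d0) => k k0 hk.
apply: le_trans (hB k k0) _; rewrite lerD2l (le_trans hk)// mulrCA.
have /andP[al0 _] := alpha01' k; have /andP[_ b1] := beta01' k.
by rewrite ler_wpM2l// ler_piMr// ltW.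
Qed.

(* Dividing the recursion for the increments by [beta k] costs an error
   [K * alpha k] times the previous increment, which tends to [0]. *)
Lemma trilevel_increments_small_beta (e : R) : 0 < e ->
  \forall k \near \oo, enorm (x k.+1 - x k) <= e * beta k.
Proof.
move=> e0; have [B B0 hB] := step_variation.
(* The divisor has index [k.-1], so that [b k.+1] is the increment from [x k] over [beta k]. *)
pose b k := enorm (x k - x k.-1) / beta k.-1.
have bcvg : \forall k \near \oo, b k <= e.
  apply: (recursive_inequality_cvg0 c01 _ alpha01' alpha_div) => // [k|d d0].
    by rewrite divr_ge0 ?enorm_ge0//; have /andP[] := beta01' k.-1.
  have d2 : 0 < d / 2 by rewrite divr_gt0.
  have dK : 0 < d / 2 / (K + 1) by rewrite divr_gt0// ltr_wpDl.
  apply: filterS3 (filterI (nbhs_infty_gt 0%N) invb_var) (varB B0 d2)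
    (trilevel_increments_cvg0 dK) => k [k0 hinv] hvar incr.
  have /andP[b0 _] := beta01 k; have /andP[a0 _] := alpha01' k.
  rewrite /b /= ler_pdivrMr// (le_trans (hB k k0))//.
  set a := enorm (x k - x k.-1) in incr *; have a_ge0 : 0 <= a by exact: enorm_ge0.
  have rate1 : 1 - (1 - r) * alpha k <= 1.
    by rewrite gerBl mulr_ge0//; case/andP: c01 => /ltW.
  have aK : a * K <= d / 2.
    move: incr; rewrite ler_pdivlMr ?ltr_wpDl//; lra.
  have ab : a / beta k <= a / beta k.-1 + alpha k * (d / 2).
    have : a * ((beta k)^-1 - (beta k.-1)^-1) <= a * (K * alpha k).
      by rewrite ler_wpM2l// (le_trans (ler_norm _)).
    have := ler_wpM2l a0 aK; lra.
  have -> : (1 - (1 - r) * alpha k) * a = (1 - (1 - r) * alpha k) * (a / beta k) * beta k.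
    by rewrite -mulrA divfK// gt_eqF.
  apply: le_trans (lerD (lexx _) hvar) _.
  rewrite (_ : d / 2 * _ = alpha k * (d / 2) * beta k); last by ring.
  rewrite -mulrDl ler_wpM2r ?(ltW b0)//.
  have := ler_wpM2l (rate_ge0 k) ab.
  have := ler_wpM2r (mulr_ge0 a0 (ltW d2)) rate1; rewrite mul1r mulrDr.
  move: (_ * (a / beta k)) (_ * (a / beta k.-1)) (_ * (alpha k * _)) => u v w; lra.
have := near_infty_succ bcvg; apply: filterS => k.
by rewrite /b /= ler_pdivrMr//; have /andP[] := beta01 k.
Qed.

(** [x k.+1 - W (x k)] carries only the weights of [S] and [T], which tend to 0, and [x k.+1 - x k]
    tends to 0 too. *)
Lemma trilevel_asymptotic_regularity (e : R) : 0 < e ->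
  \forall k \near \oo, enorm (x k - W (x k)) <= e.
Proof.
move=> e0; have [B B0 hB] := bound.
pose d := e / (1 + 4 * B); have D0 : 0 < 1 + 4 * B by lra.
have d0 : 0 < d by rewrite divr_gt0.
apply: filterS3 (near_infty_succ (trilevel_increments_cvg0 d0)) (beta_cvg d0) (alpha_beta ltr01).
move=> k xd bd; rewrite mul1r => ab; have ad := le_trans ab bd.
have /andP[a0 a1] := alpha01' k; have /andP[b0 b1] := beta01' k.
have [_ SB TB WB] := hB k.
apply: le_trans (enorm_triangle (x k.+1) _ _) _; rewrite enormBC.
set p := (1 - alpha k) * beta k.
have p0 : 0 <= p by rewrite mulr_ge0// subr_ge0.
have pd : p <= d by apply: le_trans bd; rewrite ler_piMl// gerBl.
have : enorm (x k.+1 - W (x k)) <= 4 * B * d.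
  have -> : x k.+1 - W (x k) = alpha k *: (S (x k) - W (x k)) + p *: (T (x k) - W (x k)).
    by rewrite xS; apply/rowP => i; rewrite !mxE /p; ring.
  apply: le_trans (enormD _ _) _; rewrite !enormZ (ger0_norm a0) (ger0_norm p0).
  have SW : enorm (S (x k) - W (x k)) <= 2 * B.
    by apply: le_trans (enormD _ _) _; rewrite enormN; lra.
  have TW : enorm (T (x k) - W (x k)) <= 2 * B.
    by apply: le_trans (enormD _ _) _; rewrite enormN; lra.
  have := ler_pM a0 (enorm_ge0 _) ad SW; have := ler_pM p0 (enorm_ge0 _) pd TW; lra.
have : d * (1 + 4 * B) = e by rewrite /d divfK// gt_eqF.
lra.
Qed.

(* Pairing the scheme with [x k - y] and dividing by [(1 - alpha k) * beta k],
   the [S]-part is small since [alpha = o(beta)], the [W]-part has the good sign. *)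
Lemma trilevel_asymptotic_vi (y : 'rV[R]_n) (e : R) : fixpoints W y -> 0 < e ->
  \forall k \near \oo, dotp (y - T y) (x k - y) <= e.
Proof.
move=> Wy e0; have [B B0 hB] := bound.
pose B' := B + enorm y; have B'0 : 0 < B' by rewrite ltr_pwDl// enorm_ge0.
(* Chosen so that the increment and the [S]-part together cost exactly [beta k / 2 * e]; see
   [de]. *)
pose d := e / (2 * ((1 + 2 * B) * B')).
have D0 : 0 < 2 * ((1 + 2 * B) * B') by rewrite !mulr_gt0//; lra.
have d0 : 0 < d by rewrite divr_gt0.
have h0 : 0 < 2^-1 :> R by rewrite invr_gt0.
apply: filterS3 (trilevel_increments_small_beta d0) (alpha_beta d0)
  (filterI (alpha_beta ltr01) (beta_cvg h0)) => k xd ad [].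
rewrite mul1r => ab bd; have ah := le_trans ab bd.
have /andP[a0 a1] := alpha01' k; have /andP[b0 _] := beta01 k.
have /andP[_ b1] := beta01' k.
have [xB SB TB WB] := hB k.
rewrite leNgt; apply/negP => V.
set p := (1 - alpha k) * beta k; set q := (1 - alpha k) * (1 - beta k).
have q0 : 0 <= q by rewrite mulr_ge0// subr_ge0.
have xy : enorm (x k - y) <= B' by apply: le_trans (enormD _ _) _; rewrite enormN lerD2r.
(* Since [alpha k <= 1 / 2], [p] is at least [beta k / 2]; the inner product is positive by the
   assumption to be refuted. *)
have pV : beta k / 2 * e < p * dotp (y - T y) (x k - y).
  apply: (@lt_le_trans _ _ (beta k / 2 * dotp (y - T y) (x k - y))).
    by rewrite ltr_pM2l// divr_gt0.
  rewrite ler_wpM2r ?(le_trans (ltW e0) (ltW V))//.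
  by have := ler_wpM2r (ltW b0) ah; rewrite /p; lra.
have xE : x k - x k.+1 = alpha k *: (x k - S (x k)) + p *: (x k - T (x k)) + q *: (x k - W (x k)).
  by rewrite xS; apply/rowP => i; rewrite !mxE /p /q; ring.
have Tmon := nonexpansive_complement_monotone (x k) y LT.
have Wmon := nonexpansive_complement_monotone (x k) y LW.
have Sle : alpha k * dotp (x k - S (x k)) (x k - y) >= - (d * beta k * (2 * B * B')).
  have SB' : enorm (x k - S (x k)) <= 2 * B.
    by apply: le_trans (enormD _ _) _; rewrite enormN; lra.
  have := ler_pM (enorm_ge0 _) (enorm_ge0 _) SB' xy.
  move=> /(le_trans (dotp_norm _ _)) h.
  have := ler_pM a0 (normr_ge0 _) ad h.
  have := ler_norm (- dotp (x k - S (x k)) (x k - y)); rewrite normrN => hn.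
  have := ler_wpM2l a0 hn; lra.
have Dle : dotp (x k - x k.+1) (x k - y) <= d * beta k * B'.
  apply: le_trans (dotp_le _ _) _; rewrite enormBC.
  exact: ler_pM (enorm_ge0 _) (enorm_ge0 _) xd xy.
have de : d * beta k * B' + d * beta k * (2 * B * B') = beta k / 2 * e.
  have dE : d * (2 * ((1 + 2 * B) * B')) = e by rewrite divfK// gt_eqF.
  by rewrite -[in RHS]dE; field.
have p0 : 0 <= p by rewrite mulr_ge0 ?subr_ge0// ltW.
have := ler_wpM2l p0 Tmon; have := ler_wpM2l q0 Wmon.
rewrite Wy subrr subr0 (dotpDl (x k - T (x k))) (dotpNl (y - T y)) !mulr0.
move: Dle; rewrite xE !(dotpDl (_ + _)) (dotpDl (alpha k *: _)) !dotpZl.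
lra.
Qed.


(** If the bound failed infinitely often, a cluster point along those indices would lie in [Omega]
    and violate [hvi]. *)
Lemma trilevel_limsup_vi (xs : 'rV[R]_n) (e : R) :
  (forall z, hierarchical_fixpoints T W z -> 0 <= dotp (xs - S xs) (z - xs)) ->
  0 < e -> \forall k \near \oo, dotp (S xs - xs) (x k - xs) <= e.
Proof.
move=> hvi e0.
pose Q k := e < dotp (S xs - xs) (x k - xs).
have [Qfreq|/existsNP[N hN]] := pselect (forall N, exists2 k, (N <= k)%N & Q k); last first.
  by exists N => // k Nk /=; rewrite leNgt; apply/negP => Qk; apply: hN; exists k.
have [p hp] := bolzano_weierstrass_along xM Qfreq.
have Op : hierarchical_fixpoints T W p.
  apply: hierarchical_fixpoints_approx => // [d d0|y d Wy d0].
    have [N _ hN] := trilevel_asymptotic_regularity d0.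
    by have [k [/hN Nk _ kp]] := hp d d0 N; exists (x k).
  have [N _ hN] := trilevel_asymptotic_vi Wy d0.
  by have [k [/hN Nk _ kp]] := hp d d0 N; exists (x k).
suff : e <= 0 by rewrite leNgt e0.
apply: (@ler_add_small _ _ _ (enorm (S xs - xs))) => l /andP[l0 _].
have [k [_ Qk kp]] := hp l l0 0%N.
apply: le_trans (ltW Qk) _; rewrite add0r.
have -> : x k - xs = (x k - p) + (p - xs) by rewrite subrKA.
rewrite dotpDr; have := hvi p Op; rewrite -[xs - S xs]opprB dotpNl.
have := dotp_le (S xs - xs) (x k - p).
have := ler_wpM2l (enorm_ge0 (S xs - xs)) (ltW kp); lra.
Qed.

Lemma trilevel_sqr_dist_cvg0 (xs : 'rV[R]_n) : hierarchical_fixpoints T W xs ->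
  (forall z, hierarchical_fixpoints T W z -> 0 <= dotp (xs - S xs) (z - xs)) ->
  forall e, 0 < e -> \forall k \near \oo, enorm (x k - xs) ^+ 2 <= e.
Proof.
move=> [Wxs Oxs] hvi.
apply: (recursive_inequality_cvg0 c01 _ alpha01' alpha_div) => // [k|e e0].
  exact: sqr_ge0.
pose tau := enorm (T xs - xs); have tau0 : 0 <= tau by exact: enorm_ge0.
(* Each inner product is to cost at most [alpha k * (e / 4)]; doubled and added, they give
   [alpha k * e]. *)
have D0 : 0 < 4 * (tau * C + 1) by rewrite mulr_gt0// ltr_wpDl// mulr_ge0.
have bd0 : 0 < e / (4 * (tau * C + 1)) by rewrite divr_gt0.
have e4 : 0 < e / 4 by rewrite divr_gt0.
apply: filterS3 (near_infty_succ (trilevel_limsup_vi hvi e4)) (beta_cvg bd0) dist_fix.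
move=> k Sle bd [q Wq xq].
have /andP[a0 a1] := alpha01' k; have /andP[b0 b1] := beta01' k.
set p := (1 - alpha k) * beta k.
have p0 : 0 <= p by rewrite mulr_ge0// subr_ge0.
have pb : p <= beta k by rewrite ler_piMl// gerBl.
pose G := trilevel_step S T W (alpha k) (beta k).
have xE : x k.+1 - xs = (G (x k) - G xs) + (alpha k *: (S xs - xs) + p *: (T xs - xs)).
  rewrite xS -/(G (x k)) (_ : alpha k *: _ + _ = G xs - xs) ?subrKA//.
  by rewrite /G /trilevel_step Wxs; apply/rowP => i; rewrite !mxE /p; ring.
have Gle : enorm (G (x k) - G xs) ^+ 2 <= (1 - (1 - r) * alpha k) * enorm (x k - xs) ^+ 2.
  have rate1 : 1 - (1 - r) * alpha k <= 1.
    by rewrite gerBl mulr_ge0//; case/andP: c01 => /ltW.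
  have LG := trilevel_step_lipschitz LS LT LW (alpha01' k) (beta01' k) (x k) xs.
  have := lerXn2r 2 (enorm_ge0 _) (le_trans (enorm_ge0 _) LG) LG.
  move=> /le_trans; apply; rewrite exprMn ler_wpM2r ?sqr_ge0// expr2.
  by rewrite ler_piMl.
have := sqr_enormD_le (G (x k) - G xs) (alpha k *: (S xs - xs) + p *: (T xs - xs)).
rewrite -xE (dotpDl (alpha k *: _)) !dotpZl.
(* Split at [q]: the part from [xs] to [q] has the good sign, the rest is [O(alpha k)]. *)
have Tle : dotp (T xs - xs) (x k.+1 - xs) <= tau * (C * alpha k).
  rewrite -[x k.+1](subrK q) -addrA dotpDr.
  have := Oxs q Wq; rewrite -[xs - T xs]opprB dotpNl.
  have := dotp_le (T xs - xs) (x k.+1 - q); have := ler_wpM2l tau0 xq.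
  rewrite -/tau; lra.
have pT : p * dotp (T xs - xs) (x k.+1 - xs) <= alpha k * (e / 4).
  apply: le_trans (ler_wpM2l p0 Tle) _.
  have tC : 0 <= tau * (C * alpha k) by rewrite !mulr_ge0.
  apply: le_trans (ler_wpM2r tC (le_trans pb bd)) _.
  rewrite mulrAC ler_pdivrMr//.
  have := mulr_ge0 a0 (ltW e0); lra.
have := ler_wpM2l a0 Sle; lra.
Qed.

End TrilevelIteration.

Theorem mainTheorem9 (R : realType) (n : nat)
  (f1 f2 : 'rV[R]_n -> R) (gf1 gf2 : 'rV[R]_n -> 'rV[R]_n) (Lf1 Lf2 : R)
  (g1 g2 : 'rV[R]_n -> \bar R)
  (om : 'rV[R]_n -> R) (gom : 'rV[R]_n -> 'rV[R]_n) (mu Lom : R)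
  (u t s : R) (proxT proxW : 'rV[R]_n -> 'rV[R]_n)
  (alpha beta : R^nat) (x : nat -> 'rV[R]_n) (K : R) :
  (* trilevel setting *)
  convex_fun f1 -> convex_fun f2 ->
  has_gradient f1 gf1 -> has_gradient f2 gf2 ->
  0 < Lf1 -> 0 < Lf2 -> lipschitz_with Lf1 gf1 -> lipschitz_with Lf2 gf2 ->
  proper_efun g1 -> lsc_efun g1 -> convex_efun g1 ->
  proper_efun g2 -> lsc_efun g2 -> convex_efun g2 ->
  0 < mu -> strongly_convex_fun mu om -> has_gradient om gom ->
  0 < Lom -> lipschitz_with Lom gom ->
  let phi1 := fun z => ((f1 z)%:E + g1 z)%E in
  let phi2 := fun z => ((f2 z)%:E + g2 z)%E in
  let Ystar := [set z | is_argmin_on setT phi2 z] in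
  let Xstar := [set z | is_argmin_on Ystar phi1 z] in
  Ystar !=set0 -> Xstar !=set0 ->
  0 < u <= 2 / (Lom + mu) -> 0 < t <= 1 / Lf1 -> 0 < s <= 1 / Lf2 ->
  (* proxT = prox_{t g1}, proxW = prox_{s g2} *)
  (forall z, is_prox t g1 z (proxT z)) -> (forall z, is_prox s g2 z (proxW z)) ->
  let S := fun z => z - u *: gom z in
  let T := fun z => proxT (z - t *: gf1 z) in
  let W := fun z => proxW (z - s *: gf2 z) in
  (forall k, 0 < alpha k < 1) -> (forall k, 0 < beta k < 1) ->
  (forall k, x k.+1 = alpha k *: S (x k) + ((1 - alpha k) * beta k) *: T (x k)
                      + ((1 - alpha k) * (1 - beta k)) *: W (x k)) ->
  (* hypotheses of the theorem *)
  let Omega := [set z | fixpoints W z /\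
                  forall y, fixpoints W y -> 0 <= dotp (z - T z) (y - z)] in
  Omega !=set0 ->
  (fun k => beta k / alpha k) @ \oo --> +oo ->
  beta @ \oo --> 0 -> alpha @ \oo --> 0 ->
  series alpha @ \oo --> +oo ->
  0 < K ->
  (limn_esup (fun k => (`|(beta k)^-1 - (beta k.-1)^-1| / alpha k)%:E) <= K%:E)%E ->
  limn_esup (fun k => ((`|beta k - beta k.-1| + `|alpha k - alpha k.-1|)
                          / (alpha k * beta k))%:E) = 0%E ->
  (exists M : R, forall k, enorm (x k) <= M) ->
  (* (A1)'' *)
  (limn_esup (fun k => (dist (x k.+1) (fixpoints W) / alpha k)%:E) < +oo)%E ->
  exists2 xs : 'rV[R]_n,
    [/\ Omega xs,
        (forall z, Omega z -> 0 <= dotp (xs - S xs) (z - xs)) &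
        (forall y, Omega y -> (forall z, Omega z -> 0 <= dotp (y - S y) (z - y)) -> y = xs)]
    & x @ \oo --> xs.
Proof.
move=> cf1 cf2 gf1P gf2P Lf1_gt0 Lf2_gt0 Lgf1 Lgf2 pg1 _ cg1 pg2 _ cg2.
move=> mu0 som gomP Lom0 Lgom phi1 phi2 Ystar Xstar _ _ uL tL sL proxTP proxWP.
move=> S T W alpha01 beta01 xS Omega Omega0 ba_cvg b_cvg a_cvg a_div K0.
move=> invb_var var [M xM] dist_fix.
have LT : lipschitz_with 1 T.
  exact: (forward_backward_nonexpansive cf1 gf1P Lf1_gt0 Lgf1 tL pg1 cg1 proxTP).
have LW : lipschitz_with 1 W.
  exact: (forward_backward_nonexpansive cf2 gf2P Lf2_gt0 Lgf2 sL pg2 cg2 proxWP).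
have LS := gradient_step_contraction mu0 som gomP Lom0 Lgom uL.
set r := Num.sqrt _ in LS.
have u0 : 0 < u by case/andP: uL.
have r01 : 0 <= r < 1.
  rewrite sqrtr_ge0 -sqrtr1 ltr_sqrt// gtrBl.
  by rewrite divr_gt0 ?addr_gt0// !mulr_gt0.
have r1 : r < 1 by case/andP: r01.
have [xs Oxs vi] := hierarchical_vi_exists LT LW mu0 som gomP Omega0.
have hvi z : Omega z -> 0 <= dotp (xs - S xs) (z - xs).
  by move=> /vi h; rewrite /S opprB addrC subrK dotpZl mulr_ge0// ltW.
exists xs; first split=> // y Oy hy.
  exact: (contraction_vi_unique r1 LS Oxs Oy hvi hy).
have alpha_gt0 k : 0 < alpha k by case/andP: (alpha01 k).
have beta_gt0 k : 0 < beta k by case/andP: (beta01 k).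
have alpha_beta e : 0 < e -> \forall k \near \oo, alpha k <= e * beta k.
  move=> e0; apply: filterS (cvgry_ge ba_cvg e^-1) => k.
  by rewrite ler_pdivlMr// ler_pdivrMl.
have beta_small e : 0 < e -> \forall k \near \oo, beta k <= e.
  move=> e0; have /cvgrPdist_le/(_ e e0) := b_cvg; apply: filterS => k.
  by rewrite sub0r normrN; exact: le_trans (ler_norm _).
(* An upper limit at most [K] gives eventual bounds only by constants above [K], hence [K + 1]. *)
have K1 : 0 <= K + 1 by rewrite addr_ge0// ltW.
have invb_var' : \forall k \near \oo,
    `|(beta k)^-1 - (beta k.-1)^-1| <= (K + 1) * alpha k.
  have /limn_esup_lt_near : (limn_esup (fun k =>
      (`|(beta k)^-1 - (beta k.-1)^-1| / alpha k)%:E) < (K + 1)%:E)%E.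
    by apply: le_lt_trans invb_var _; rewrite lte_fin ltrDl.
  by apply: filterS => k /ltW; rewrite ler_pdivrMr.
have var' e : 0 < e -> \forall k \near \oo,
    `|beta k - beta k.-1| + `|alpha k - alpha k.-1| <= e * (alpha k * beta k).
  move=> e0; have /limn_esup_lt_near : (limn_esup (fun k =>
      ((`|beta k - beta k.-1| + `|alpha k - alpha k.-1|) / (alpha k * beta k))%:E)
      < e%:E)%E by rewrite var lte_fin.
  by apply: filterS => k /ltW; rewrite ler_pdivrMr// mulr_gt0.
have [C C0 hC] := limn_esup_lty_near dist_fix.
have dist_fix' : \forall k \near \oo,
    exists2 q, fixpoints W q & enorm (x k.+1 - q) <= C * alpha k.
  apply: filterS hC => k; rewrite ltr_pdivrMr// => /dist_approx[|q Wq /ltW].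
    by case: Oxs => Wxs _; exists xs.
  by exists q.
have := trilevel_sqr_dist_cvg0 r01 LS LT LW alpha01 beta01 xS alpha_beta beta_small
  a_div K1 invb_var' var' xM (ltW C0) dist_fix' Oxs hvi.
(* Convergence is stated in the sup norm, which [enorm] dominates; squares are compared with
   [e ^+ 2]. *)
move=> sqr_cvg; apply/cvgrPdist_le => e e0.
apply: filterS (sqr_cvg _ (exprn_gt0 2 e0)) => k.
rewrite ler_pXn2r ?nnegrE ?enorm_ge0 ?(ltW e0)// => h.
by rewrite (le_trans (norm_le_enorm _))// enormBC.
Qed.
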